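(* Let $r(\alpha,t)$ be the solution of the $d$-dimensional problem $r''=ke_0(\alpha)\,r^{-\nu}$, $\nu:=d-1$, with initial data $(r,r')(\alpha,0)=(\alpha,u_0(\alpha))$, $u_0(\alpha)>0$ (where $'=d/dt$), and let $u(r,t)=r'(\alpha,t)$ be the velocity along the flow map. Then, according to the value of $\nu$: - $\nu=0$: the flow map is given by $$r(\alpha,t)=\alpha+u_0(\alpha)t+\frac{ke_0(\alpha)}{2}t^2,$$ and the velocity is $u(r,t)=u_0(\alpha)+ke_0(\alpha)t$. - $\nu=1$: the flow map is $$r(\alpha,t)=\alpha\exp\left(\frac{ke_0}{2}\tau^2+u_0\tau\right),$$ with the parameter $\tau$ given implicitly by the temporal relation $$t=\alpha\int_0^\tau\exp\left(\frac{ke_0}{2}\xi^2+u_0\xi\right)d\xi.$$ In this case we have $$\sqrt{\alpha^2+2\alpha u_0t+ke_0t^2}\le r(\alpha,t)\le\alpha+u_0t+O(t\ln t).$$ The corresponding velocity is given by $u(r,t)=h(\alpha,t)$, with $h(\alpha,t)\sim u_0+O(t\ln t)$ determined implicitly by the identity $$t\equiv\int_{u_0(\alpha)}^{h(\alpha,t)}\exp\left(\frac{\xi^2-u_0^2}{2ke_0}\right)d\xi.$$ - $\nu=2$: $r=r(\alpha,t)$ is given implicitly by $$\frac{2Q(\alpha)}{R}t=\cosh^{-1}\left(\frac{2r}{R}-1\right)-\cosh^{-1}\left(\frac{u_0^2}{ke_0}\right)+\frac{2}{R}\sqrt{r^2-Rr}-\frac{u_0}{\sqrt{ke_0}},$$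 with $$Q(\alpha):=\sqrt{u_0^2+\frac{2ke_0}{\alpha}},\qquad R(\alpha):=\frac{2ke_0}{u_0^2+\frac{2ke_0}{\alpha}}.$$ In this case we have $$\left[\alpha^3+3\alpha^2u_0t+\tfrac32ke_0t^2\right]^{1/3}\le r(\alpha,t)\le\alpha+\sqrt{u_0^2+\frac{2ke_0}{\alpha}}\;t,$$ the velocity is uniformly bounded in time, and $$\lim_{t\to\infty}u(r,t)=Q(\alpha).$$
   Context: Here $k>0$ is a constant, $\alpha\in\mathbb{R}^+$ is the initial position, and $u_0=u_0(\alpha)$ is the initial velocity. The quantity $e_0=e_0(\alpha)=\int_0^\alpha n_0(\xi)\xi^\nu\,d\xi$ is the weighted initial mass, with $n_0\ge0$ the initial density. The equation for $r$ describes the particle paths (flow map $\frac{d}{dt}r(\alpha,t)=u(r(\alpha,t),t)$, $r(\alpha,0)=\alpha$) of the isotropic Euler-Poisson system $r^\nu n_t+(nur^\nu)_r=0$, $u_t+uu_r=-k\phi_r$, $(r^\nu\phi_r)_r=-nr^\nu$ with initial data $(n_0,u_0)$. Order symbols refer to large $t$ with $\alpha$ fixed.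
   Formalization: Two formulas corrected: the ν=1 velocity identity gains the factor α/(ke_0); for ν=2 the constants become cosh^{-1}(αu_0²/(ke_0)+1) and αQu_0/(ke_0). These two formulas are asserted only for e_0>0. *)

(* Defs.v *)
From Stdlib Require Import Reals Lra.
From Coquelicot Require Import Coquelicot.
Open Scope R_scope.

Definition weighted_mass (n0 : R -> R) (nu : nat) (alpha : R) : R :=
  RInt (fun xi => n0 xi * xi ^ nu) 0 alpha.

(* Derivative relative to the half-line [0, +oo): the usual derivative at
   t > 0, the right derivative at t = 0. *)
Definition is_derive_fwd (f : R -> R) (t l : R) : Prop :=
  filterdiff f (within (fun s => 0 <= s) (locally t)) (fun y => scal y l).

(* [r alpha] is the particle path issued from [alpha] for the velocity field
   [u = u(r, t)], and it solves r'' = k e0(alpha) r^(-nu) for all t >= 0. *)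
Definition flow_path (k : R) (nu : nat) (n0 u0 : R -> R)
    (r u : R -> R -> R) (alpha : R) : Prop :=
  r alpha 0 = alpha /\
  u (r alpha 0) 0 = u0 alpha /\
  forall t, 0 <= t ->
    is_derive_fwd (r alpha) t (u (r alpha t) t) /\
    is_derive_fwd (fun s => u (r alpha s) s) t
      (k * weighted_mass n0 nu alpha / r alpha t ^ nu).

(* f(t) = O(g(t)) as t -> +oo *)
Definition bigO_infty (f g : R -> R) : Prop :=
  exists C T : R, forall t, T <= t -> Rabs (f t) <= C * Rabs (g t).

(* Principal branch of cosh^(-1); meaningful for 1 <= x. *)
Definition arcosh (x : R) : R := ln (x + sqrt (x ^ 2 - 1)).

Lemma arcosh_ge0 (x : R) : 1 <= x -> 0 <= arcosh x.
Proof.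
intros Hx; unfold arcosh; rewrite <- ln_1.
pose proof (sqrt_pos (x ^ 2 - 1)).
destruct (Req_dec (x + sqrt (x ^ 2 - 1)) 1) as [->|]; [lra|].
left; apply ln_increasing; lra.
Qed.

Lemma cosh_arcosh (x : R) : 1 <= x -> cosh (arcosh x) = x.
Proof.
intros Hx; unfold arcosh, cosh.
assert (Hs : sqrt (x ^ 2 - 1) * sqrt (x ^ 2 - 1) = x ^ 2 - 1)
  by (apply sqrt_sqrt; nra).
pose proof (sqrt_pos (x ^ 2 - 1)).
rewrite exp_Ropp, exp_ln by lra.
set (s := sqrt (x ^ 2 - 1)) in *.
apply (Rmult_eq_reg_r (2 * (x + s))); [|lra].
field_simplify; [nra|lra].
Qed.

(* For nu = 2 the energy integral reads r'^2 = Q^2 (1 - R / r); integrating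
   dr / sqrt (1 - R / r) = Q dt from r = alpha uses
   2 alpha / R - 1 = alpha u0^2 / (k e0) + 1 and
   (2 / R) sqrt (alpha^2 - R alpha) = alpha Q u0 / (k e0). *)
Definition Qinf (k e0 u0 alpha : R) : R := sqrt (u0 ^ 2 + 2 * k * e0 / alpha).

Definition Rstar (k e0 u0 alpha : R) : R :=
  2 * k * e0 / (u0 ^ 2 + 2 * k * e0 / alpha).

(* Main.v *)
(* Along the path put v = r' and c = k e0.  Once r > 0 is known, every identity
   and bound follows by comparing the derivatives of its two sides in t.
   The conserved energies are v ^ 2 - 2 c ln r for nu = 1 and v ^ 2 + 2 c / r for
   nu = 2; the lower bounds come from (r ^ nu v)' >= c, the growth for nu = 1
   from v' = c / r <= c / (r 0 + v 0 t).  For nu = 2 the energy gives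
   sqrt (r ^ 2 - R r) = r v / Q, so the implicit relation can be differentiated
   without square roots. *)
Require Import Defs.
From Stdlib Require Import Reals Lra Lia.
From Coquelicot Require Import Coquelicot.
Open Scope R_scope.

(* [auto_derive] leaves eta-expanded [Derive]s, which [rewrite] does not match. *)
Ltac rewrite_Derive H :=
  match type of H with
  | is_derive ?f ?t ?l =>
      replace (Derive (fun x : R => f x) t) with l
        by (symmetry; apply is_derive_unique; exact H)
  end.

(** * One-sided derivatives and comparison of functions through their derivatives *)

(** Continuing [f] to negative times by its tangent line at 0 turns the right derivative at 0 into a
    two-sided one, so the ordinary calculus of derivatives applies on the closed half-line. *)
Lemma is_derive_fwd_extend (f f' : R -> R) :
  (forall t, 0 <= t -> is_derive_fwd f t (f' t)) ->
  exists g : R -> R, (forall t, 0 <= t -> g t = f t) /\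
    forall t, 0 <= t -> is_derive g t (f' t).
Proof.
intros Hf.
set (g := fun y => if Rle_dec 0 y then f y else f 0 + y * f' 0).
assert (Hg : forall t, 0 <= t -> g t = f t)
  by (intros t Ht; unfold g; destruct (Rle_dec 0 t); [reflexivity | lra]).
exists g; split; [exact Hg |].
intros t Ht; destruct (Hf t Ht) as [Hlin Hdom].
split; [exact Hlin |].
intros x Hx eps.
assert (t = x) as <- by exact (is_filter_lim_locally_unique t x Hx).
(* The domination clause of [filterdiff] ranges over limit points of the filter; [t] is one for the
   restricted filter as well. *)
assert (Hlim : is_filter_lim (within (fun s => 0 <= s) (locally t)) t)
  by (intros P HP; apply filter_le_within; exact HP).
specialize (Hdom t Hlim eps); unfold within in Hdom.
destruct Ht as [Ht | <-].
- assert (Hpos : locally t (fun y => 0 < y))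
    by exact (open_gt 0 t Ht).
  generalize (filter_and _ _ Hpos Hdom); apply filter_imp.
  intros y [Hy Hd]; rewrite !Hg by lra; apply Hd; lra.
- revert Hdom; apply filter_imp; intros y Hd.
  destruct (Rle_lt_dec 0 y) as [Hy | Hy].
  + rewrite !Hg by lra; exact (Hd Hy).
  (* Left of 0 the extension is exactly affine with slope [f' 0], so the remainder vanishes. *)
  + rewrite (Hg 0) by lra; unfold g.
    destruct (Rle_dec 0 y); [lra |].
    replace (minus _ _) with 0.
    * change (norm 0) with (Rabs 0); rewrite Rabs_R0.
      apply Rmult_le_pos; [apply Rlt_le, cond_pos | apply norm_ge_0].
    * unfold minus, plus, opp, scal; simpl; unfold mult; simpl; ring.
Qed.

(** Mean value theorem for [g - f] on [[0, t]]. *)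
Lemma derive_le_compare (f g f' g' : R -> R) :
  (forall t, 0 <= t -> is_derive f t (f' t)) ->
  (forall t, 0 <= t -> is_derive g t (g' t)) ->
  (forall t, 0 <= t -> f' t <= g' t) ->
  f 0 <= g 0 -> forall t, 0 <= t -> f t <= g t.
Proof.
intros Hf Hg Hle H0 t Ht.
assert (Hd : forall x, 0 <= x ->
  is_derive (fun s => g s - f s) x (g' x - f' x))
  by (intros x Hx; apply (is_derive_minus g f); auto).
destruct (MVT_gen (fun s => g s - f s) 0 t (fun s => g' s - f' s))
  as [x [Hx Heq]].
- intros x Hx; rewrite Rmin_left in Hx by lra; apply Hd; lra.
- intros x Hx; rewrite Rmin_left in Hx by lra.
  apply derivable_continuous_pt; eexists; apply is_derive_Reals, Hd; lra.
- rewrite Rmin_left in Hx by lra.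
  specialize (Hle x ltac:(lra)); nra.
Qed.

Lemma derive_eq_compare (f g f' : R -> R) :
  (forall t, 0 <= t -> is_derive f t (f' t)) ->
  (forall t, 0 <= t -> is_derive g t (f' t)) ->
  f 0 = g 0 -> forall t, 0 <= t -> f t = g t.
Proof.
intros Hf Hg H0 t Ht; apply Rle_antisym.
- apply (derive_le_compare f g f' f'); auto with real.
- apply (derive_le_compare g f f' f'); auto with real.
Qed.

(** Freezing the argument at 0 for negative times gives continuity on the whole line, the form in
    which the intermediate value theorem and the integral lemmas are applied. *)
Lemma continuous_comp_Rmax0 (f f' : R -> R) :
  (forall t, 0 <= t -> is_derive f t (f' t)) ->
  forall t, continuous (fun s => f (Rmax 0 s)) t.
Proof.
intros Hf t; apply (continuous_comp (Rmax 0) f).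
- apply (continuous_ext (fun s => (s + Rabs s) / 2)).
  + intros s; unfold Rmax, Rabs.
    destruct (Rle_dec 0 s), (Rcase_abs s); lra.
  + apply (continuous_mult (fun s => s + Rabs s) (fun _ => / 2));
      [| apply continuous_const].
    apply (continuous_plus (fun s => s) Rabs);
      [apply continuous_id | apply continuous_Rabs].
- apply (ex_derive_continuous f); eexists; apply Hf, Rmax_l.
Qed.

(** A positive integrand makes the integral strictly increasing in its upper bound; this yields
    uniqueness in the implicit relations for [nu = 1]. *)
Lemma RInt_pos_inj (f : R -> R) (a x y : R) :
  (forall s, continuous f s) -> (forall s, 0 < f s) ->
  RInt f a x = RInt f a y -> x = y.
Proof.
intros Hc Hpos Heq.
assert (Hex : forall p q, ex_RInt f p q)
  by (intros; apply (ex_RInt_continuous (V := R_CompleteNormedModule)); auto).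
assert (Hlt : forall p q, p < q -> RInt f a p < RInt f a q).
{ intros p q Hpq.
  rewrite <- (RInt_Chasles f a p q) by auto.
  assert (0 < RInt f p q) by (apply RInt_gt_0; auto).
  unfold plus; simpl; lra. }
destruct (Rtotal_order x y) as [H | [H | H]]; auto;
  apply Hlt in H; lra.
Qed.

Lemma is_derive_RInt_comp (f p : R -> R) (a t p' : R) :
  (forall s, continuous f s) -> is_derive p t p' ->
  is_derive (fun s => RInt f a (p s)) t (p' * f (p t)).
Proof.
intros Hc Hp.
apply (is_derive_comp (fun x => RInt f a x) p); [| exact Hp].
apply (is_derive_RInt f (fun x => RInt f a x) a); [| apply Hc].
apply filter_forall; intros x; apply (@RInt_correct R_CompleteNormedModule).
apply (ex_RInt_continuous (V := R_CompleteNormedModule)); auto.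
Qed.

(** * Trajectories: monotonicity, linear bounds and positivity *)

(** The equation as a first-order system with [c = k e0]. The derivatives are two-sided even at
    [t = 0], as provided by [is_derive_fwd_extend]. *)
Definition trajectory (c : R) (nu : nat) (r v : R -> R) : Prop :=
  forall t, 0 <= t -> is_derive r t (v t) /\ is_derive v t (c / r t ^ nu).

(** The hypothesis concerns the sign of the acceleration rather than that of [r], so that
    [position_pos_2] can rely on this before positivity is known. *)
Lemma velocity_ge (c : R) (nu : nat) (r v : R -> R) :
  trajectory c nu r v -> (forall t, 0 <= t -> 0 <= c / r t ^ nu) ->
  forall t, 0 <= t -> v 0 <= v t.
Proof.
intros H Hacc.
apply (derive_le_compare (fun _ => v 0) v (fun _ => 0) (fun t => c / r t ^ nu)).
- intros; apply (is_derive_const (v 0)).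
- intros t Ht; apply (H t Ht).
- exact Hacc.
- lra.
Qed.

Lemma position_ge (c : R) (nu : nat) (r v : R -> R) :
  trajectory c nu r v -> (forall t, 0 <= t -> 0 <= c / r t ^ nu) ->
  forall t, 0 <= t -> r 0 + v 0 * t <= r t.
Proof.
intros H Hacc.
apply (derive_le_compare (fun t => r 0 + v 0 * t) r (fun _ => v 0) v).
- intros t Ht; auto_derive; [exact I | ring].
- intros t Ht; apply (H t Ht).
- intros t Ht; apply (velocity_ge c nu r v); auto.
- lra.
Qed.

(** Follows from [(t v)' = v + t v' >= v = r']. *)
Lemma position_le (c : R) (nu : nat) (r v : R -> R) :
  trajectory c nu r v -> (forall t, 0 <= t -> 0 <= c / r t ^ nu) ->
  forall t, 0 <= t -> r t <= r 0 + v t * t.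
Proof.
intros H Hacc.
apply (derive_le_compare r (fun t => r 0 + v t * t) v
  (fun t => v t + c / r t ^ nu * t)).
- intros t Ht; apply (H t Ht).
- intros t Ht; destruct (H t Ht) as [_ Hv].
  auto_derive; [exists (c / r t ^ nu); exact Hv |].
  rewrite_Derive Hv; ring.
- intros t Ht; generalize (Rmult_le_pos _ _ (Hacc t Ht) Ht); lra.
- lra.
Qed.

(* Since [/ 0 = 0], [(r v)'] is [v ^ 2 + c] or [v ^ 2], so [r v] increases and
   [r] cannot vanish, without assuming beforehand that [r] stays positive. *)
Lemma position_pos_1 (c : R) (r v : R -> R) :
  0 <= c -> 0 < r 0 -> 0 < v 0 -> trajectory c 1 r v ->
  forall t, 0 <= t -> 0 < r t.
Proof.
intros Hc Hr0 Hv0 H.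
assert (Hrv : forall t, 0 <= t -> r 0 * v 0 <= r t * v t).
{ apply (derive_le_compare (fun _ => r 0 * v 0) (fun t => r t * v t)
    (fun _ => 0) (fun t => v t * v t + r t * (c / r t ^ 1))).
  - intros; apply @is_derive_const.
  - intros t Ht; destruct (H t Ht).
    apply (is_derive_mult r v t (v t)); auto; intros; apply Rmult_comm.
  - intros t Ht; rewrite pow_1; unfold Rdiv.
    destruct (Req_dec (r t) 0) as [E | E].
    + rewrite E; nra.
    + replace (r t * (c * / r t)) with c by (field; auto); nra.
  - lra. }
intros t Ht; destruct (Rlt_le_dec 0 (r t)) as [| Hneg]; auto; exfalso.
destruct (IVT_gen (fun s => r (Rmax 0 s)) 0 t 0) as [x [_ Hx]].
- intros x; apply continuity_pt_filterlim.
  apply (continuous_comp_Rmax0 r v); intros; apply H; auto.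
- rewrite (Rmax_right 0 t), (Rmax_left 0 0) by lra.
  rewrite Rmin_right, Rmax_left by lra; lra.
- generalize (Hrv _ (Rmax_l 0 x)); rewrite Hx; nra.
Qed.

Lemma acceleration_nonneg (c : R) (nu : nat) (x : R) :
  0 <= c -> 0 < x -> 0 <= c / x ^ nu.
Proof.
intros Hc Hx; apply Rmult_le_pos; auto.
apply Rlt_le, Rinv_0_lt_compat, pow_lt, Hx.
Qed.

(** The even power makes the acceleration nonnegative whatever the sign of [r], with value 0 at
    [r = 0] since [/ 0 = 0]; the linear lower bound then applies directly. *)
Lemma position_pos_2 (c : R) (r v : R -> R) :
  0 <= c -> 0 < r 0 -> 0 < v 0 -> trajectory c 2 r v ->
  forall t, 0 <= t -> 0 < r t.
Proof.
intros Hc Hr0 Hv0 H t Ht.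
apply Rlt_le_trans with (r 0 + v 0 * t); [nra |].
apply (position_ge c 2 r v); auto; intros s Hs.
destruct (Req_dec (r s) 0) as [E | E].
- rewrite E, pow_i, Rdiv_0_r by lia; lra.
- apply Rmult_le_pos; auto; apply Rlt_le, Rinv_0_lt_compat.
  rewrite <- Rsqr_pow2; apply Rsqr_pos_lt, E.
Qed.

(** * The case [nu = 0]: constant acceleration *)

Lemma trajectory_0 (c : R) (r v : R -> R) :
  trajectory c 0 r v -> forall t, 0 <= t ->
  v t = v 0 + c * t /\ r t = r 0 + v 0 * t + c / 2 * t ^ 2.
Proof.
intros H.
assert (Hv : forall t, 0 <= t -> v t = v 0 + c * t).
{ apply (derive_eq_compare v (fun t => v 0 + c * t) (fun _ => c)).
  - intros t Ht; destruct (H t Ht) as [_ Hv].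
    rewrite pow_O, Rdiv_1_r in Hv; exact Hv.
  - intros; auto_derive; [exact I | ring].
  - ring. }
intros t Ht; split; auto; revert t Ht.
apply (derive_eq_compare r (fun t => r 0 + v 0 * t + c / 2 * t ^ 2)
  (fun t => v 0 + c * t)).
- intros t Ht; rewrite <- Hv by auto; apply (H t Ht).
- intros; auto_derive; [exact I | field].
- ring.
Qed.

(** * Conserved energies for [nu = 1] and [nu = 2] *)

(** The ratio [r t / r 0] is kept inside the logarithm so that, for [c > 0], exponentiating gives [r
    / r 0 = exp ((v ^ 2 - v 0 ^ 2) / (2 c))], the integrand of the velocity identity. *)
Lemma energy_1 (c : R) (r v : R -> R) :
  trajectory c 1 r v -> (forall t, 0 <= t -> 0 < r t) ->
  forall t, 0 <= t -> v t ^ 2 - v 0 ^ 2 = 2 * c * ln (r t / r 0).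
Proof.
intros H Hpos.
assert (H0 : 0 < r 0) by (apply Hpos; lra).
apply (derive_eq_compare (fun t => v t ^ 2 - v 0 ^ 2)
  (fun t => 2 * c * ln (r t / r 0)) (fun t => 2 * v t * (c / r t))).
- intros t Ht; destruct (H t Ht) as [Hr Hv]; rewrite pow_1 in Hv.
  auto_derive; [eexists; exact Hv |].
  rewrite_Derive Hv; ring.
- intros t Ht; destruct (H t Ht) as [Hr Hv].
  generalize (Hpos t Ht); intros Hrt.
  auto_derive.
  + split; [eexists; exact Hr | split; [| exact I]].
    apply Rdiv_lt_0_compat; auto.
  + rewrite_Derive Hr; field; lra.
- rewrite Rdiv_diag, ln_1 by lra; ring.
Qed.

Lemma energy_2 (c : R) (r v : R -> R) :
  trajectory c 2 r v -> (forall t, 0 <= t -> 0 < r t) ->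
  forall t, 0 <= t -> v t ^ 2 + 2 * c / r t = v 0 ^ 2 + 2 * c / r 0.
Proof.
intros H Hpos.
apply (derive_eq_compare (fun t => v t ^ 2 + 2 * c / r t)
  (fun _ => v 0 ^ 2 + 2 * c / r 0) (fun _ => 0)); [| | reflexivity].
- intros t Ht; destruct (H t Ht) as [Hr Hv].
  generalize (Hpos t Ht); intros Hrt.
  auto_derive.
  + repeat split; [eexists; exact Hv | eexists; exact Hr | lra].
  + rewrite_Derive Hv.
    rewrite_Derive Hr; field; lra.
- intros; apply @is_derive_const.
Qed.

(** * The case [nu = 1]: implicit formulas for position and velocity *)

Lemma exp_quadratic_continuous (a b x : R) :
  continuous (fun xi => exp (a * xi ^ 2 + b * xi)) x.
Proof.
apply @ex_derive_continuous; auto_derive; exact I.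
Qed.

(* The parameter is [tau t = RInt (1 / r) 0 t], so that [v = v 0 + c tau] and
   [(ln r)' = (v 0 + c tau) tau']. *)
Lemma trajectory_1_param (c : R) (r v : R -> R) :
  0 < r 0 -> trajectory c 1 r v -> (forall t, 0 <= t -> 0 < r t) ->
  exists tau : R -> R, forall t, 0 <= t ->
    (forall x,
       t = r 0 * RInt (fun xi => exp (c / 2 * xi ^ 2 + v 0 * xi)) 0 x
       <-> x = tau t) /\
    r t = r 0 * exp (c / 2 * tau t ^ 2 + v 0 * tau t).
Proof.
intros Hr0 H Hpos.
(* With [Rmax 0 s] the integrand is continuous on the whole line, so [tau] is differentiable at
   [t = 0] too. *)
set (w := fun s => / r (Rmax 0 s)).
assert (Hw : forall t, continuous w t).
{ intros t; apply (continuous_comp (fun s => r (Rmax 0 s)) Rinv).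
  - apply (continuous_comp_Rmax0 r v); intros; apply H; auto.
  - apply continuous_Rinv, Rgt_not_eq, Hpos, Rmax_l. }
set (tau := fun t => RInt w 0 t); exists tau.
assert (Htau0 : tau 0 = 0) by apply @RInt_point.
assert (Hdtau : forall t, 0 <= t -> is_derive tau t (/ r t)).
{ intros t Ht.
  replace (/ r t) with (1 * w t)
    by (unfold w; rewrite Rmax_right by auto; ring).
  apply (is_derive_RInt_comp w (fun s => s)); [exact Hw |].
  apply @is_derive_id. }
assert (Hv : forall t, 0 <= t -> v t = v 0 + c * tau t).
{ apply (derive_eq_compare v _ (fun t => c / r t)).
  - intros t Ht; destruct (H t Ht) as [_ Hv].
    rewrite pow_1 in Hv; exact Hv.
  - intros t Ht; specialize (Hdtau t Ht).
    auto_derive; [eexists; exact Hdtau |].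
    rewrite_Derive Hdtau; unfold Rdiv; ring.
  - rewrite Htau0; ring. }
assert (Hln : forall t, 0 <= t ->
  ln (r t / r 0) = c / 2 * tau t ^ 2 + v 0 * tau t).
{ apply (derive_eq_compare (fun t => ln (r t / r 0))
    (fun t => c / 2 * tau t ^ 2 + v 0 * tau t) (fun t => v t / r t)).
  - intros t Ht; destruct (H t Ht) as [Hr _].
    generalize (Hpos t Ht); intros Hrt.
    auto_derive.
    + split; [eexists; exact Hr | split; [| exact I]].
      apply Rdiv_lt_0_compat; auto.
    + rewrite_Derive Hr; field; lra.
  - intros t Ht; rewrite (Hv t Ht); specialize (Hdtau t Ht).
    auto_derive; [repeat split; eexists; exact Hdtau |].
    rewrite_Derive Hdtau.
    field; apply Rgt_not_eq, Hpos, Ht.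
  - rewrite Htau0, Rdiv_diag, ln_1 by lra; ring. }
assert (Hr : forall t, 0 <= t ->
  r t = r 0 * exp (c / 2 * tau t ^ 2 + v 0 * tau t)).
{ intros t Ht; rewrite <- Hln by auto.
  rewrite exp_ln by (apply Rdiv_lt_0_compat; auto); field; lra. }
set (f := fun xi => exp (c / 2 * xi ^ 2 + v 0 * xi)) in *.
(* Change of variable [dt = r dtau]: since [tau' = 1 / r] and [r = r 0 * f tau], the right side has
   derivative 1. *)
assert (Ht : forall t, 0 <= t -> t = r 0 * RInt f 0 (tau t)).
{ apply (derive_eq_compare (fun t => t) (fun t => r 0 * RInt f 0 (tau t))
    (fun _ => 1)).
  - intros; apply @is_derive_id.
  - intros t Ht.
    replace 1 with (r 0 * (/ r t * f (tau t))).
    + apply (is_derive_scal (fun t => RInt f 0 (tau t))).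
      apply is_derive_RInt_comp; auto.
      intros; apply exp_quadratic_continuous.
    + generalize (Hpos t Ht) (Hr t Ht); intros Hp E.
      replace (r 0 * (/ r t * f (tau t))) with (/ r t * (r 0 * f (tau t)))
        by ring.
      change (r t = r 0 * f (tau t)) in E; rewrite <- E; field; lra.
  - rewrite Htau0, @RInt_point; unfold zero; simpl; ring. }
intros t Htp; split; [| apply Hr, Htp].
intros x; split; [| intros ->; apply Ht, Htp].
intros Hx; rewrite (Ht t Htp) in Hx at 1.
apply Rmult_eq_reg_l in Hx; [| lra]; symmetry; revert Hx.
apply RInt_pos_inj; intros s;
  [apply exp_quadratic_continuous | apply exp_pos].
Qed.

(** From [dv = (c / r) dt] one has [dt = (r / c) dv], and [energy_1] expresses [r] through [v]; the
    factor [r 0 / c] arises here. *)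
Lemma trajectory_1_velocity (c : R) (r v : R -> R) :
  0 < c -> trajectory c 1 r v -> (forall t, 0 <= t -> 0 < r t) ->
  forall t, 0 <= t -> forall x,
    t = r 0 / c * RInt (fun xi => exp ((xi ^ 2 - v 0 ^ 2) / (2 * c))) (v 0) x
    <-> x = v t.
Proof.
intros Hc H Hpos.
assert (Hr0 : 0 < r 0) by (apply Hpos; lra).
set (f := fun xi => exp ((xi ^ 2 - v 0 ^ 2) / (2 * c))).
assert (Hf : forall s, continuous f s)
  by (intros s; apply @ex_derive_continuous; unfold f; auto_derive; exact I).
assert (Ht : forall t, 0 <= t -> t = r 0 / c * RInt f (v 0) (v t)).
{ apply (derive_eq_compare (fun t => t)
    (fun t => r 0 / c * RInt f (v 0) (v t)) (fun _ => 1)).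
  - intros; apply @is_derive_id.
  - intros t Ht; generalize (Hpos t Ht); intros Hrt.
    replace 1 with (r 0 / c * (c / r t ^ 1 * f (v t))).
    + apply (is_derive_scal (fun t => RInt f (v 0) (v t))).
      apply is_derive_RInt_comp; auto; apply (H t Ht).
    + unfold f; rewrite (energy_1 c r v H Hpos t Ht).
      replace (2 * c * ln (r t / r 0) / (2 * c)) with (ln (r t / r 0))
        by (field; lra).
      rewrite exp_ln by (apply Rdiv_lt_0_compat; auto); field; lra.
  - rewrite @RInt_point; unfold zero; simpl; ring. }
intros t Htp x; split; [| intros ->; apply Ht, Htp].
intros Hx; rewrite (Ht t Htp) in Hx at 1.
apply Rmult_eq_reg_l in Hx.
- symmetry; revert Hx; apply RInt_pos_inj; auto; intros; apply exp_pos.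
- apply Rgt_not_eq, Rdiv_lt_0_compat; auto.
Qed.

(** * The case [nu = 1]: bounds and growth for large time *)

(** Two integrations: [(r v)' = v ^ 2 + c >= c] bounds [r v], and [(r ^ 2)' = 2 r v] then bounds
    [r ^ 2]. *)
Lemma trajectory_1_lower (c : R) (r v : R -> R) :
  0 < r 0 -> trajectory c 1 r v -> (forall t, 0 <= t -> 0 < r t) ->
  forall t, 0 <= t ->
  sqrt (r 0 ^ 2 + 2 * r 0 * v 0 * t + c * t ^ 2) <= r t.
Proof.
intros Hr0 H Hpos.
assert (Hrv : forall t, 0 <= t -> r 0 * v 0 + c * t <= r t * v t).
{ apply (derive_le_compare (fun t => r 0 * v 0 + c * t) (fun t => r t * v t)
    (fun _ => c) (fun t => v t ^ 2 + c)).
  - intros; auto_derive; [exact I | ring].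
  - intros t Ht; destruct (H t Ht) as [Hr Hv].
    generalize (Hpos t Ht); intros Hrt.
    auto_derive; [repeat split; [eexists; exact Hr | eexists; exact Hv] |].
    rewrite_Derive Hv.
    rewrite_Derive Hr; field; lra.
  - intros; nra.
  - lra. }
intros t Ht; rewrite <- (sqrt_pow2 (r t)) by (apply Rlt_le, Hpos, Ht).
apply sqrt_le_1_alt; revert t Ht.
apply (derive_le_compare
  (fun t => r 0 ^ 2 + 2 * r 0 * v 0 * t + c * t ^ 2) (fun t => r t ^ 2)
  (fun t => 2 * (r 0 * v 0 + c * t)) (fun t => 2 * (r t * v t))).
- intros; auto_derive; [exact I | ring].
- intros t Ht; destruct (H t Ht) as [Hr _].
  auto_derive; [eexists; exact Hr |].
  rewrite_Derive Hr; ring.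
- intros t Ht; generalize (Hrv t Ht); lra.
- lra.
Qed.

Lemma trajectory_1_velocity_log (c : R) (r v : R -> R) :
  0 <= c -> 0 < v 0 -> trajectory c 1 r v -> (forall t, 0 <= t -> 0 < r t) ->
  forall t, 0 <= t -> v t <= v 0 + c / v 0 * ln (1 + v 0 / r 0 * t).
Proof.
intros Hc Hv0 H Hpos.
assert (Hr0 : 0 < r 0) by (apply Hpos; lra).
assert (Hq : 0 < v 0 / r 0) by (apply Rdiv_lt_0_compat; auto).
apply (derive_le_compare v (fun t => v 0 + c / v 0 * ln (1 + v 0 / r 0 * t))
  (fun t => c / r t) (fun t => c / (r 0 + v 0 * t))).
- intros t Ht; destruct (H t Ht) as [_ Hv].
  rewrite pow_1 in Hv; exact Hv.
- intros t Ht; auto_derive; [nra |].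
  assert (0 < r 0 + v 0 * t) by nra.
  field; repeat split; nra.
- intros t Ht; apply Rmult_le_compat_l; auto.
  apply Rinv_le_contravar; [nra |].
  apply (position_ge c 1 r v); auto.
  intros; apply acceleration_nonneg; auto.
- rewrite Rmult_0_r, Rplus_0_r, ln_1; lra.
Qed.

(** For [t >= 1] one has [1 + q t <= (1 + q) t]; the threshold [exp 1] gives [ln t >= 1], which
    absorbs the constant [ln (1 + q)]. *)
Lemma ln_affine_le (q t : R) :
  0 < q -> exp 1 <= t -> ln (1 + q * t) <= (1 + ln (1 + q)) * ln t.
Proof.
intros Hq Ht.
assert (He : 1 < exp 1) by (generalize (exp_ineq1 1); lra).
assert (Hlt : 1 <= ln t)
  by (rewrite <- (ln_exp 1); apply ln_le; [apply exp_pos | auto]).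
assert (Hlq : 0 < ln (1 + q)) by (rewrite <- ln_1; apply ln_increasing; lra).
apply Rle_trans with (ln ((1 + q) * t)).
- assert (0 < q * t) by (apply Rmult_lt_0_compat; lra).
  apply ln_le; lra.
- rewrite ln_mult by lra; nra.
Qed.

Lemma trajectory_1_asymptotics (c : R) (r v : R -> R) :
  0 <= c -> 0 < v 0 -> trajectory c 1 r v -> (forall t, 0 <= t -> 0 < r t) ->
  bigO_infty (fun t => r t - r 0 - v 0 * t) (fun t => t * ln t) /\
  bigO_infty (fun t => v t - v 0) (fun t => t * ln t).
Proof.
intros Hc Hv0 H Hpos.
assert (Hr0 : 0 < r 0) by (apply Hpos; lra).
assert (Hq : 0 < v 0 / r 0) by (apply Rdiv_lt_0_compat; auto).
assert (Hacc : forall t, 0 <= t -> 0 <= c / r t ^ 1)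
  by (intros; apply acceleration_nonneg; auto).
set (C := c / v 0 * (1 + ln (1 + v 0 / r 0))).
assert (He : 1 < exp 1) by (generalize (exp_ineq1 1); lra).
assert (Hlt : forall t, exp 1 <= t -> 1 <= ln t)
  by (intros; rewrite <- (ln_exp 1); apply ln_le; [apply exp_pos | auto]).
assert (Hv : forall t, exp 1 <= t -> v t - v 0 <= C * ln t).
{ intros t Ht.
  apply Rle_trans with (c / v 0 * ln (1 + v 0 / r 0 * t)).
  - generalize (trajectory_1_velocity_log c r v Hc Hv0 H Hpos t); lra.
  - unfold C; rewrite Rmult_assoc.
    apply Rmult_le_compat_l; [| apply ln_affine_le; auto].
    apply Rmult_le_pos; [auto | apply Rlt_le, Rinv_0_lt_compat, Hv0]. }
(* One constant serves both estimates: [0 <= v - v 0 <= C ln t], and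
   [0 <= r - r 0 - v 0 t <= (v - v 0) t]. *)
split; exists C, (exp 1); intros t Ht; specialize (Hlt t Ht);
  specialize (Hv t Ht); assert (Ht0 : 0 <= t) by lra;
  generalize (position_ge c 1 r v H Hacc t Ht0)
    (position_le c 1 r v H Hacc t Ht0) (velocity_ge c 1 r v H Hacc t Ht0);
  intros Hp1 Hp2 Hv1; rewrite !Rabs_pos_eq; try nra.
Qed.

(** * The case [nu = 2]: bounds and limit velocity *)

(** Two integrations: [(r ^ 2 v)' = 2 r v ^ 2 + c >= c], then [(r ^ 3)' = 3 r ^ 2 v]. *)
Lemma trajectory_2_lower (c : R) (r v : R -> R) :
  0 <= c -> 0 < v 0 -> trajectory c 2 r v -> (forall t, 0 <= t -> 0 < r t) ->
  forall t, 0 <= t ->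
  Rpower (r 0 ^ 3 + 3 * r 0 ^ 2 * v 0 * t + 3 / 2 * c * t ^ 2) (1 / 3) <= r t.
Proof.
intros Hc Hv0 H Hpos.
assert (Hr0 : 0 < r 0) by (apply Hpos; lra).
assert (Hrv : forall t, 0 <= t -> r 0 ^ 2 * v 0 + c * t <= r t ^ 2 * v t).
{ apply (derive_le_compare (fun t => r 0 ^ 2 * v 0 + c * t)
    (fun t => r t ^ 2 * v t) (fun _ => c) (fun t => 2 * r t * v t ^ 2 + c)).
  - intros; auto_derive; [exact I | ring].
  - intros t Ht; destruct (H t Ht) as [Hr Hv].
    generalize (Hpos t Ht); intros Hrt.
    auto_derive; [repeat split; [eexists; exact Hr | eexists; exact Hv] |].
    rewrite_Derive Hv; rewrite_Derive Hr; field; lra.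
  - intros t Ht; generalize (Hpos t Ht) (pow2_ge_0 (v t)); nra.
  - lra. }
assert (Hcube : forall t, 0 <= t ->
  r 0 ^ 3 + 3 * r 0 ^ 2 * v 0 * t + 3 / 2 * c * t ^ 2 <= r t ^ 3).
{ apply (derive_le_compare
    (fun t => r 0 ^ 3 + 3 * r 0 ^ 2 * v 0 * t + 3 / 2 * c * t ^ 2)
    (fun t => r t ^ 3)
    (fun t => 3 * (r 0 ^ 2 * v 0 + c * t)) (fun t => 3 * (r t ^ 2 * v t))).
  - intros; auto_derive; [exact I | field].
  - intros t Ht; destruct (H t Ht) as [Hr _].
    auto_derive; [eexists; exact Hr |].
    rewrite_Derive Hr; ring.
  - intros t Ht; generalize (Hrv t Ht); lra.
  - lra. }
intros t Ht; generalize (Hpos t Ht); intros Hrt.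
replace (r t) with (Rpower (r t ^ 3) (1 / 3)) at 1.
(* [Rpower] is defined through [ln], so its monotonicity in the base is used with a positive lower
   base. *)
- apply Rle_Rpower_l; [lra | split; [| apply Hcube, Ht]].
  assert (0 < r 0 ^ 3) by (apply pow_lt; auto).
  assert (0 <= r 0 ^ 2 * v 0 * t)
    by (repeat apply Rmult_le_pos; auto; lra).
  assert (0 <= c * t ^ 2) by (apply Rmult_le_pos; auto; apply pow2_ge_0).
  lra.
- rewrite <- Rpower_pow, Rpower_mult by auto.
  replace (INR 3 * (1 / 3)) with 1 by (simpl; field).
  apply Rpower_1, Hrt.
Qed.

Lemma trajectory_2_velocity_le (c : R) (r v : R -> R) :
  0 <= c -> trajectory c 2 r v -> (forall t, 0 <= t -> 0 < r t) ->
  forall t, 0 <= t -> v t <= sqrt (v 0 ^ 2 + 2 * c / r 0).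
Proof.
intros Hc H Hpos t Ht.
rewrite <- (energy_2 c r v H Hpos t Ht).
assert (0 <= 2 * c / r t)
  by (apply Rdiv_le_0_compat; [lra | apply Hpos, Ht]).
apply Rle_trans with (Rabs (v t)); [apply Rle_abs |].
rewrite <- sqrt_Rsqr_abs, Rsqr_pow2; apply sqrt_le_1_alt; lra.
Qed.

Lemma trajectory_2_upper (c : R) (r v : R -> R) :
  0 <= c -> trajectory c 2 r v -> (forall t, 0 <= t -> 0 < r t) ->
  forall t, 0 <= t -> r t <= r 0 + sqrt (v 0 ^ 2 + 2 * c / r 0) * t.
Proof.
intros Hc H Hpos; set (Q := sqrt _).
apply (derive_le_compare r (fun t => r 0 + Q * t) v (fun _ => Q)).
- intros t Ht; apply (H t Ht).
- intros; auto_derive; [exact I | ring].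
- apply trajectory_2_velocity_le; auto.
- lra.
Qed.

(** A squeeze: the linear growth [r >= v 0 t] makes the gap between [v] and its bound of order
    [1 / t]. *)
Lemma trajectory_2_velocity_lim (c : R) (r v : R -> R) :
  0 <= c -> 0 < v 0 -> trajectory c 2 r v -> (forall t, 0 <= t -> 0 < r t) ->
  is_lim v p_infty (sqrt (v 0 ^ 2 + 2 * c / r 0)).
Proof.
intros Hc Hv0 H Hpos; set (Q := sqrt _).
assert (Hr0 : 0 < r 0) by (apply Hpos; lra).
assert (Hacc : forall t, 0 <= t -> 0 <= c / r t ^ 2)
  by (intros; apply acceleration_nonneg; auto).
assert (HQ2 : Q ^ 2 = v 0 ^ 2 + 2 * c / r 0).
{ apply pow2_sqrt, Rplus_le_le_0_compat; [apply pow2_ge_0 |].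
  apply Rdiv_le_0_compat; lra. }
(* [Q - v = (2 c / r) / (Q + v)] *)
apply (is_lim_le_le_loc (fun t => Q - 2 * c / v 0 * / (v 0 * t)) (fun _ => Q)).
- exists 0; intros t Ht.
  assert (Ht0 : 0 <= t) by lra.
  generalize (Hpos t Ht0) (energy_2 c r v H Hpos t Ht0)
    (velocity_ge c 2 r v H Hacc t Ht0) (position_ge c 2 r v H Hacc t Ht0)
    (trajectory_2_velocity_le c r v Hc H Hpos t Ht0).
  fold Q; rewrite <- HQ2; intros Hrt He Hvt Hrge HvQ.
  split; [| exact HvQ].
  assert (Hinv : / r t <= / (v 0 * t)) by (apply Rinv_le_contravar; nra).
  apply Rmult_le_reg_l with (v 0); auto.
  replace (v 0 * (Q - 2 * c / v 0 * / (v 0 * t)))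
    with (v 0 * Q - 2 * c * / (v 0 * t)) by (field; lra).
  (* Uses [v 0 <= Q + v] in [(Q + v) (Q - v) = 2 c / r]. *)
  assert (v 0 * (Q - v t) <= 2 * c * / r t) by (unfold Rdiv in He; nra).
  nra.
- replace (Finite Q) with (Finite (Q - 2 * c / v 0 * 0))
    by (f_equal; ring).
  apply is_lim_minus'; [apply is_lim_const |].
  apply (is_lim_scal_l _ (2 * c / v 0) p_infty 0).
  replace (Finite 0) with (Rbar_inv p_infty) by reflexivity.
  apply is_lim_inv; [| discriminate].
  replace p_infty with (Rbar_mult (v 0) p_infty) at 2.
  + apply is_lim_scal_l, is_lim_id.
  + simpl; destruct (Rle_dec 0 (v 0)) as [L |]; [| lra].
    destruct (Rle_lt_or_eq_dec 0 (v 0) L); [reflexivity | lra].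
- apply is_lim_const.
Qed.

(** * The case [nu = 2]: implicit relation for the position *)

(** Since [(2 x / a - 1) ^ 2 - 1 = (2 / a) ^ 2 (x ^ 2 - a x)], the root hidden in [arcosh] is the
    one appearing explicitly in the implicit relation. *)
Lemma arcosh_rescale (a x : R) :
  0 < a -> a <= x ->
  arcosh (2 * x / a - 1)
  = ln (2 * x / a - 1 + 2 / a * sqrt (x ^ 2 - a * x)).
Proof.
intros Ha Hx; unfold arcosh; do 2 f_equal.
replace (2 / a) with (sqrt ((2 / a) ^ 2))
  by (apply sqrt_pow2, Rdiv_le_0_compat; lra).
rewrite <- sqrt_mult by (try apply pow2_ge_0; nra).
f_equal; field; lra.
Qed.

Lemma implicit_time_increasing (a x y : R) :
  0 < a -> a <= x -> x < y ->
  arcosh (2 * x / a - 1) + 2 / a * sqrt (x ^ 2 - a * x)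
  < arcosh (2 * y / a - 1) + 2 / a * sqrt (y ^ 2 - a * y).
Proof.
intros Ha Hx Hxy; rewrite !arcosh_rescale by lra.
assert (Hs : sqrt (x ^ 2 - a * x) < sqrt (y ^ 2 - a * y))
  by (apply sqrt_lt_1_alt; nra).
assert (Ha2 : 0 < 2 / a) by (apply Rdiv_lt_0_compat; lra).
assert (H1 : 1 <= x / a) by (apply Rle_div_r; lra).
assert (Hd : 2 * x / a < 2 * y / a)
  by (apply Rmult_lt_compat_r; [apply Rinv_0_lt_compat |]; lra).
generalize (sqrt_pos (x ^ 2 - a * x)); intros Hs0.
apply Rplus_lt_compat.
- apply ln_increasing; [| nra].
  replace (2 * x / a) with (2 * (x / a)) by (field; lra); nra.
- apply Rmult_lt_compat_l; auto.
Qed.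

(** Along the path the relation becomes [ln p + w] with [p] and [w] rational in [r] and [v], whose
    derivative is the constant [2 Q / a]. Uniqueness among [x >= a], where the argument of [arcosh]
    is at least 1, comes from [implicit_time_increasing]. *)
Lemma trajectory_2_implicit (c : R) (r v : R -> R) :
  0 < c -> 0 < v 0 -> trajectory c 2 r v -> (forall t, 0 <= t -> 0 < r t) ->
  let Q := sqrt (v 0 ^ 2 + 2 * c / r 0) in
  let a := 2 * c / (v 0 ^ 2 + 2 * c / r 0) in
  forall t, 0 <= t ->
    a <= r t /\
    forall x, a <= x ->
      (2 * Q / a * t
         = arcosh (2 * x / a - 1) - arcosh (r 0 * v 0 ^ 2 / c + 1)
           + 2 / a * sqrt (x ^ 2 - a * x) - r 0 * Q * v 0 / c
       <-> x = r t).
Proof.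
intros Hc Hv0 H Hpos Q a.
assert (Hr0 : 0 < r 0) by (apply Hpos; lra).
assert (Hacc : forall t, 0 <= t -> 0 <= c / r t ^ 2)
  by (intros; apply acceleration_nonneg; auto; lra).
assert (Hcr : 0 < 2 * c / r 0) by (apply Rdiv_lt_0_compat; lra).
assert (Hq : 0 < v 0 ^ 2 + 2 * c / r 0) by nra.
assert (HQ : 0 < Q) by (apply sqrt_lt_R0, Hq).
assert (HQ2 : Q ^ 2 = v 0 ^ 2 + 2 * c / r 0) by (apply pow2_sqrt; lra).
assert (Ha : a = 2 * c / Q ^ 2) by (rewrite HQ2; reflexivity).
clearbody a.
assert (Ha0 : 0 < a)
  by (rewrite Ha; apply Rdiv_lt_0_compat; [lra | apply pow_lt, HQ]).
assert (HE : forall t, 0 <= t -> v t ^ 2 + 2 * c / r t = Q ^ 2)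
  by (intros; rewrite HQ2; apply energy_2; auto).
assert (Hvt : forall t, 0 <= t -> 0 < v t)
  by (intros t Ht; generalize (velocity_ge c 2 r v H Hacc t Ht); lra).
assert (HcE : forall t, 0 <= t -> 2 * c = r t * (Q ^ 2 - v t ^ 2)).
{ intros t Ht; rewrite <- HE with t by auto.
  field; apply Rgt_not_eq, Hpos, Ht. }
(* By the energy, [a = 2 c / Q ^ 2 = r (1 - v ^ 2 / Q ^ 2)], and [v > 0]. *)
assert (Har : forall t, 0 <= t -> a < r t).
{ intros t Ht; rewrite Ha; apply Rlt_div_l; [apply pow_lt, HQ |].
  rewrite (HcE t Ht); apply Rmult_lt_compat_l; [apply Hpos, Ht |].
  generalize (pow_lt _ 2 (Hvt t Ht)); lra. }
assert (Hsqrt : forall t, 0 <= t ->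
  sqrt (r t ^ 2 - a * r t) = r t * v t / Q).
{ intros t Ht; generalize (Hpos t Ht) (Hvt t Ht); intros.
  rewrite <- (sqrt_pow2 (r t * v t / Q)).
  - f_equal; rewrite Ha, (HcE t Ht); field; lra.
  - apply Rdiv_le_0_compat; nra. }
(* By [Hsqrt], [w] is the square-root term of the relation, and [p] is the argument of the logarithm
   in [arcosh_rescale]. *)
set (w := fun t => 2 / a * (r t * v t / Q)).
set (p := fun t => 2 * r t / a - 1 + w t).
assert (Hp : forall t, 0 <= t -> 0 < p t).
{ intros t Ht; generalize (Hpos t Ht) (Hvt t Ht) (Har t Ht); intros.
  assert (1 < r t / a) by (apply Rlt_div_r; lra).
  assert (0 < w t)
    by (unfold w; repeat apply Rmult_lt_0_compat; auto;
        try apply Rinv_0_lt_compat; lra).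
  unfold p; replace (2 * r t / a) with (2 * (r t / a)) by (field; lra); lra. }
assert (Htime : forall t, 0 <= t ->
  2 * Q / a * t = ln (p t) + w t - (ln (p 0) + w 0)).
{ apply (derive_eq_compare (fun t => 2 * Q / a * t)
    (fun t => ln (p t) + w t - (ln (p 0) + w 0)) (fun _ => 2 * Q / a)).
  - intros; auto_derive; [exact I | ring].
  - intros t Ht; destruct (H t Ht) as [Hr Hv].
    generalize (Hpos t Ht) (Hvt t Ht) (Hp t Ht) (HcE t Ht);
      intros Hrt Hvt' Hpt Hct.
    assert (Hw : is_derive w t (2 / a * ((v t ^ 2 + c / r t) / Q))).
    { unfold w; auto_derive.
      - repeat split; [eexists; exact Hr | eexists; exact Hv].
      - rewrite_Derive Hr; rewrite_Derive Hv; field; repeat split; lra. }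
    assert (Hdp : is_derive p t
      (2 * v t / a + 2 / a * ((v t ^ 2 + c / r t) / Q))).
    { unfold p; auto_derive.
      - repeat split; [eexists; exact Hr | eexists; exact Hw].
      - rewrite_Derive Hr; rewrite_Derive Hw; field; repeat split; lra. }
    auto_derive.
    + repeat split; [eexists; exact Hdp | exact Hpt | eexists; exact Hw].
    + rewrite_Derive Hdp; rewrite_Derive Hw.
      assert (HQv2 : v t ^ 2 < Q ^ 2)
        by (generalize (HE t Ht) (Rdiv_lt_0_compat (2 * c) (r t)); lra).
      assert (HQv : 0 < Q - v t) by nra.
      (* Eliminating [c] and [a] in favour of [r], [v], [Q] collapses [p] to [(Q + v) / (Q - v)] and
         leaves a rational identity. *)
      assert (Hc' : c = r t * (Q ^ 2 - v t ^ 2) / 2) by lra.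
      assert (Ha' : a = r t * (Q ^ 2 - v t ^ 2) / Q ^ 2)
        by (rewrite Ha, Hct; field; lra).
      assert (Hpv : p t = (Q + v t) / (Q - v t)).
      { unfold p, w; rewrite Ha'; field; repeat split; nra. }
      rewrite Hpv, Ha', Hc'; field; repeat split; nra.
  - ring. }
assert (Harc : forall t, 0 <= t ->
  arcosh (2 * r t / a - 1) + 2 / a * sqrt (r t ^ 2 - a * r t)
  = ln (p t) + w t).
{ intros t Ht; rewrite arcosh_rescale, Hsqrt by (auto; apply Rlt_le, Har, Ht).
  reflexivity. }
assert (Hinit : ln (p 0) + w 0
  = arcosh (r 0 * v 0 ^ 2 / c + 1) + r 0 * Q * v 0 / c).
{ rewrite <- Harc, Hsqrt by lra; f_equal.
  - f_equal; replace (v 0 ^ 2) with (Q ^ 2 - 2 * c / r 0) by lra.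
    rewrite Ha; field; lra.
  - rewrite Ha; field; lra. }
intros t Ht; split; [apply Rlt_le, Har, Ht |].
intros x Hx; generalize (Htime t Ht) (Harc t Ht); intros Ht1 Ht2.
split; [| intros ->; lra].
intros Hxt; generalize (Har t Ht); intros Hat.
destruct (Rtotal_order x (r t)) as [Hlt | [| Hlt]]; auto; exfalso;
  apply (implicit_time_increasing a) in Hlt; lra.
Qed.

(** * Back to the flow map and the three cases *)

(** [p] and [v] extend the path and the velocity along it to negative times, which replaces forward
    derivatives by two-sided ones. *)
Lemma flow_path_trajectory (k : R) (nu : nat) (n0 u0 : R -> R)
    (r u : R -> R -> R) (alpha : R) :
  flow_path k nu n0 u0 r u alpha ->
  exists p v : R -> R,
    (forall t, 0 <= t -> p t = r alpha t /\ v t = u (r alpha t) t) /\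
    p 0 = alpha /\ v 0 = u0 alpha /\
    trajectory (k * weighted_mass n0 nu alpha) nu p v.
Proof.
intros [Hr0 [Hu0 Hd]].
destruct (is_derive_fwd_extend (r alpha) (fun t => u (r alpha t) t))
  as [p [Hp Hdp]]; [intros t Ht; apply (Hd t Ht) |].
destruct (is_derive_fwd_extend (fun s => u (r alpha s) s)
    (fun t => k * weighted_mass n0 nu alpha / r alpha t ^ nu))
  as [v [Hv Hdv]]; [intros t Ht; apply (Hd t Ht) |].
exists p, v; split; [auto | split; [| split]].
- rewrite Hp; auto; lra.
- rewrite Hv; auto; lra.
- intros t Ht; rewrite (Hp t Ht), (Hv t Ht); split; auto.
Qed.

Lemma weighted_mass_ge0 (n0 : R -> R) (nu : nat) (alpha : R) :
  0 <= alpha -> (forall xi, 0 <= xi -> 0 <= n0 xi) ->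
  ex_RInt (fun xi => n0 xi * xi ^ nu) 0 alpha ->
  0 <= weighted_mass n0 nu alpha.
Proof.
intros Ha Hn Hex; apply RInt_ge_0; auto.
intros x Hx; apply Rmult_le_pos; [apply Hn; lra | apply pow_le; lra].
Qed.

Theorem lemma5p3 (d : nat) (k : R) (n0 u0 : R -> R) (r u : R -> R -> R)
    (alpha : R) :
  let nu := (d - 1)%nat in
  let e0 := weighted_mass n0 nu alpha in
  let U0 := u0 alpha in
  let Q := Qinf k e0 U0 alpha in
  let RR := Rstar k e0 U0 alpha in
  (1 <= d)%nat ->
  0 < k ->
  0 < alpha ->
  (forall xi, 0 <= xi -> 0 <= n0 xi) ->
  ex_RInt (fun xi => n0 xi * xi ^ nu) 0 alpha ->
  0 < U0 ->
  flow_path k nu n0 u0 r u alpha ->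
  (nu = 0%nat ->
     forall t, 0 <= t ->
       r alpha t = alpha + U0 * t + k * e0 / 2 * t ^ 2 /\
       u (r alpha t) t = U0 + k * e0 * t)
  /\
  (nu = 1%nat ->
     (exists tau : R -> R, forall t, 0 <= t ->
        (forall x,
           t = alpha * RInt (fun xi => exp (k * e0 / 2 * xi ^ 2 + U0 * xi)) 0 x
           <-> x = tau t) /\
        r alpha t = alpha * exp (k * e0 / 2 * tau t ^ 2 + U0 * tau t)) /\
     (exists g : R -> R, bigO_infty g (fun t => t * ln t) /\
        forall t, 0 <= t ->
          sqrt (alpha ^ 2 + 2 * alpha * U0 * t + k * e0 * t ^ 2) <= r alpha t
          <= alpha + U0 * t + g t) /\
     (exists h : R -> R,
        (forall t, 0 <= t -> u (r alpha t) t = h t) /\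
        bigO_infty (fun t => h t - U0) (fun t => t * ln t) /\
        (0 < e0 -> forall t, 0 <= t -> forall x,
           t = alpha / (k * e0)
               * RInt (fun xi => exp ((xi ^ 2 - U0 ^ 2) / (2 * k * e0))) U0 x
           <-> x = h t)))
  /\
  (nu = 2%nat ->
     (0 < e0 -> forall t, 0 <= t ->
        RR <= r alpha t /\
        forall x, RR <= x ->
          (2 * Q / RR * t
             = arcosh (2 * x / RR - 1) - arcosh (alpha * U0 ^ 2 / (k * e0) + 1)
               + 2 / RR * sqrt (x ^ 2 - RR * x) - alpha * Q * U0 / (k * e0)
           <-> x = r alpha t)) /\
     (forall t, 0 <= t ->
        Rpower (alpha ^ 3 + 3 * alpha ^ 2 * U0 * t + 3 / 2 * k * e0 * t ^ 2)
               (1 / 3) <= r alpha t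
        <= alpha + sqrt (U0 ^ 2 + 2 * k * e0 / alpha) * t) /\
     (exists M : R, forall t, 0 <= t -> Rabs (u (r alpha t) t) <= M) /\
     is_lim (fun t => u (r alpha t) t) p_infty Q).
Proof.
intros nu e0 U0 Q RR _ Hk Halpha Hn Hex HU0 Hflow.
assert (He0 : 0 <= e0) by (apply weighted_mass_ge0; auto; lra).
destruct (flow_path_trajectory _ _ _ _ _ _ _ Hflow)
  as [p [v [Heq [Hp0 [Hv0 H]]]]].
fold e0 in H; fold U0 in Hv0.
assert (Hc : 0 <= k * e0) by (apply Rmult_le_pos; lra).
assert (Hr : forall t, 0 <= t -> r alpha t = p t)
  by (intros t Ht; symmetry; apply (Heq t Ht)).
assert (Hu : forall t, 0 <= t -> u (r alpha t) t = v t)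
  by (intros t Ht; symmetry; apply (Heq t Ht)).
clearbody U0 e0; subst alpha U0.
clear Heq Hflow Hex Hn.
split; [| split]; intros Hnu; rewrite Hnu in H.
- intros t Ht; rewrite (Hu t Ht), (Hr t Ht).
  destruct (trajectory_0 _ _ _ H t Ht); auto.
- assert (Hpos := position_pos_1 _ _ _ Hc Halpha HU0 H).
  split; [| split].
  + destruct (trajectory_1_param _ _ _ Halpha H Hpos) as [tau Htau].
    exists tau; intros t Ht; rewrite (Hr t Ht); exact (Htau t Ht).
  (* Taking [g] to be the exact remainder turns the upper bound into an equality; only its growth
     has to be estimated. *)
  + exists (fun t => p t - p 0 - v 0 * t); split.
    * apply (trajectory_1_asymptotics (k * e0) p v); auto.
    * intros t Ht; rewrite (Hr t Ht); split; [| lra].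
      apply trajectory_1_lower; auto.
  + exists v; split; [exact Hu | split].
    * apply (trajectory_1_asymptotics (k * e0) p v); auto.
    * intros He t Ht x; rewrite (Rmult_assoc 2 k e0).
      apply trajectory_1_velocity; auto; apply Rmult_lt_0_compat; auto.
- assert (Hpos := position_pos_2 _ _ _ Hc Halpha HU0 H).
  assert (Hacc : forall t, 0 <= t -> 0 <= k * e0 / p t ^ 2)
    by (intros; apply acceleration_nonneg; auto).
  unfold Q, RR, Qinf, Rstar; rewrite (Rmult_assoc 2 k e0).
  split; [| split; [| split]].
  + intros He t Ht; rewrite (Hr t Ht).
    apply trajectory_2_implicit; auto; apply Rmult_lt_0_compat; auto.
  + intros t Ht; rewrite (Hr t Ht); split.
    * rewrite (Rmult_assoc (3 / 2) k e0); apply trajectory_2_lower; auto.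
    * apply trajectory_2_upper; auto.
  (* The bound is the limit velocity [Q], which the energy never lets [v] exceed. *)
  + exists (sqrt (v 0 ^ 2 + 2 * (k * e0) / p 0)); intros t Ht.
    rewrite (Hu t Ht), Rabs_pos_eq.
    * apply trajectory_2_velocity_le; auto.
    * generalize (velocity_ge _ _ _ _ H Hacc t Ht); lra.
  + apply (is_lim_ext_loc v).
    * exists 0; intros t Ht; symmetry; apply Hu; lra.
    * apply trajectory_2_velocity_lim; auto.
Qed.
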